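(* For all positive integers $d,r,k$ with $1\le r\le k\le d$, the sets $\mathcal{F}$ and $\mathcal{CR}1$ (defined in the context, for these $d,r,k$) satisfy $$\mathcal{F}\;\subseteq\;\mathcal{CR}1\;\subseteq\;\rho_{\mathcal{CR}1}\cdot \mathrm{conv}(\mathcal{F}),$$ where $\rho_{\mathcal{CR}1}=2+\max\{6\sqrt{2\pi},\,12\sqrt{\log_2 (50r)}\}$ (in particular $\rho_{\mathcal{CR}1}=O(\sqrt{\log r})$).
   Context: All matrices are real. For $V\in\mathbb{R}^{d\times r}$, $V_{i,:}$ denotes the $i$-th row, and $\|V\|_0$ denotes the number of non-zero rows of $V$. For $p,q$, the operator norm is $\|V\|_{p\to q}=\max_{\|x\|_p=1}\|Vx\|_q$, and $\|V\|_{\mathrm{op}}=\|V\|_{2\to2}$ (the largest singular value). $I^r$ is the $r\times r$ identity matrix, $\mathrm{conv}$ is the convex hull, and $\rho\cdot S=\{\rho x: x\in S\}$. $\mathcal{F}=\{V\in\mathbb{R}^{d\times r}: V^\top V=I^r,\ \|V\|_0\le k\}$. $\mathcal{CR}1=\{V\in\mathbb{R}^{d\times r}: \|V\|_{\mathrm{op}}\le 1,\ \|V\|_{2\to1}\le\sqrt{k},\ \sum_{i=1}^d\|V_{i,:}\|_2\le\sqrt{rk}\}$. *)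

(* Defs.v *)
From mathcomp Require Import all_boot all_order all_algebra.
From mathcomp Require Import all_classical all_reals all_analysis.

Set Implicit Arguments.
Unset Strict Implicit.
Unset Printing Implicit Defensive.

Import Order.TTheory GRing.Theory Num.Theory.
Import numFieldNormedType.Exports.

Local Open Scope classical_set_scope.
Local Open Scope ring_scope.

Definition lpnorm (R : realType) (p : R) (n : nat) (x : 'cV[R]_n) : R :=
  (\sum_(i < n) `|x i 0| `^ p) `^ p^-1.

(* For [0 < r], [0 < p] and [0 < q] the supremum is a maximum: the unit sphere
   of [lpnorm p] is then nonempty and compact, and [lpnorm q] is continuous. *)
Definition opnorm (R : realType) (p q : R) (d r : nat) (V : 'M[R]_(d, r)) : R :=
  sup [set lpnorm q (V *m x) | x in [set x : 'cV[R]_r | lpnorm p x = 1]].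

Definition nnz_rows (R : realType) (d r : nat) (V : 'M[R]_(d, r)) : nat :=
  #|[pred i : 'I_d | row i V != 0]|.

Definition calF (R : realType) (d r k : nat) : set 'M[R]_(d, r) :=
  [set V | V^T *m V = 1%:M /\ (nnz_rows V <= k)%N].
Arguments calF : clear implicits.

Definition CR1 (R : realType) (d r k : nat) : set 'M[R]_(d, r) :=
  [set V | [/\ opnorm 2 2 V <= 1,
               opnorm 2 1 V <= Num.sqrt k%:R &
               \sum_(i < d) lpnorm 2 (row i V)^T <= Num.sqrt (r * k)%:R]].
Arguments CR1 : clear implicits.

Definition conv_hull (R : realType) (E : lmodType R) (S : set E) : set E :=
  smallest (fun A => @convex_set R E A) S.

Definition log2 (R : realType) (x : R) : R := ln x / ln 2.

Definition rho_CR1 (R : realType) (r : nat) : R :=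
  2 + Num.max (6 * Num.sqrt (2 * pi)) (12 * Num.sqrt (log2 (50 * r%:R))).

(* Main.v *)
(* The inclusion holds with the absolute constant 53/4, which is below
   [rho_CR1].  Given V in CR1, the bound on [opnorm 2 1 V] and the little
   Grothendieck theorem, together with the bound on the sum of the row norms,
   give weights q_i with sum k such that the rows a_i = V_i / q_i have norm at
   most 2 and sum_i q_i a_i^T a_i <= 36.  Draw k indices independently with
   probabilities q_i / k, and let N = 16 + sum_i m_i^2 a_i^T a_i, where m_i is
   the multiplicity of i.  Summing over the k draws j the matrix whose only
   nonzero row, at the index i_j, is a_(i_j) N_(-j)^-1, where N_(-j) omits the
   draw j, gives a random matrix with at most k nonzero rows; by a rank-one
   update it has operator norm at most 1/4.  By independence its mean is V T
   with T = E[N_(-j)^-1] >= 1/53, so V is an average of k-row-sparse matrices of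
   norm at most 53/4.  Finally, a contraction supported on k >= r rows is a
   convex combination of isometries supported on the same rows, because rank-one
   perturbations decrease the rank of 1 - W^T W. *)

Require Import Defs.
From mathcomp Require Import all_boot all_order all_algebra.
From mathcomp Require Import all_classical all_reals all_analysis.
From mathcomp Require Import ring lra.

Set Implicit Arguments.
Unset Strict Implicit.
Unset Printing Implicit Defensive.

Import Order.TTheory GRing.Theory Num.Theory.
Import numFieldNormedType.Exports.

Local Open Scope classical_set_scope.
Local Open Scope ring_scope.

(** * Inner products, squared norms and positive semidefinite forms *)

Definition dotv (R : comNzRingType) n (x y : 'cV[R]_n) : R := (x^T *m y) 0 0.
Definition sqn (R : comNzRingType) n (x : 'cV[R]_n) : R := dotv x x.

Section Dot.
Variables (R : comNzRingType) (n : nat).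
Implicit Types (x y z : 'cV[R]_n).

Lemma dotvE x y : dotv x y = \sum_i x i 0 * y i 0.
Proof. by rewrite /dotv mxE; apply: eq_bigr => i _; rewrite mxE. Qed.

Lemma dotvC x y : dotv x y = dotv y x.
Proof. by rewrite !dotvE; apply: eq_bigr => i _; rewrite mulrC. Qed.

Lemma dotvDr x y z : dotv x (y + z) = dotv x y + dotv x z.
Proof. by rewrite /dotv mulmxDr mxE. Qed.

Lemma dotvZr a x y : dotv x (a *: y) = a * dotv x y.
Proof. by rewrite /dotv -scalemxAr mxE. Qed.

Lemma dotvDl x y z : dotv (x + y) z = dotv x z + dotv y z.
Proof. by rewrite !(dotvC _ z) dotvDr. Qed.

Lemma dotvZl a x y : dotv (a *: x) y = a * dotv x y.
Proof. by rewrite !(dotvC _ y) dotvZr. Qed.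

Lemma dotvNr x y : dotv x (- y) = - dotv x y.
Proof. by rewrite -scaleN1r dotvZr mulN1r. Qed.

Lemma dotvNl x y : dotv (- x) y = - dotv x y.
Proof. by rewrite -scaleN1r dotvZl mulN1r. Qed.

Lemma dotv0 x : dotv x 0 = 0.
Proof. by rewrite /dotv mulmx0 mxE. Qed.

Lemma dotv0l x : dotv 0 x = 0.
Proof. by rewrite dotvC dotv0. Qed.

Lemma dotv_sumr (I : Type) (s : seq I) (F : I -> 'cV[R]_n) x :
  dotv x (\sum_(i <- s) F i) = \sum_(i <- s) dotv x (F i).
Proof. by rewrite /dotv mulmx_sumr summxE. Qed.

Lemma sqnE x : sqn x = \sum_i x i 0 ^+ 2.
Proof. by rewrite /sqn dotvE. Qed.

Lemma sqnZ a x : sqn (a *: x) = a ^+ 2 * sqn x.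
Proof. by rewrite /sqn dotvZl dotvZr mulrA expr2. Qed.

Lemma sqnD x y : sqn (x + y) = sqn x + 2 * dotv x y + sqn y.
Proof. by rewrite /sqn dotvDl !dotvDr (dotvC y x); ring. Qed.

Lemma sqnN x : sqn (- x) = sqn x.
Proof. by rewrite /sqn dotvNl dotvNr opprK. Qed.

Lemma dotv_mul (m : nat) (A : 'M[R]_(m, n)) (x : 'cV[R]_m) y :
  dotv x (A *m y) = dotv (A^T *m x) y.
Proof. by rewrite /dotv trmx_mul trmxK mulmxA. Qed.

Lemma mulmx_rank1 (m : nat) (w : 'cV[R]_m) x y : w *m x^T *m y = dotv x y *: w.
Proof.
apply/matrixP => i j; rewrite -mulmxA mxE big_ord1 [j]ord1 mulrC.
by rewrite [in RHS]mxE.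
Qed.

Lemma mulmx_row m (V : 'M[R]_(m, n)) x i : (V *m x) i 0 = dotv (row i V)^T x.
Proof. by rewrite mxE dotvE; apply: eq_bigr => j _; rewrite !mxE. Qed.

End Dot.

Section Real.
Variables (R : realFieldType).

Lemma sqn_ge0 n (x : 'cV[R]_n) : 0 <= sqn x.
Proof. by rewrite sqnE sumr_ge0 // => i _; rewrite sqr_ge0. Qed.

Lemma sqn_eq0 n (x : 'cV[R]_n) : (sqn x == 0) = (x == 0).
Proof.
apply/eqP/eqP => [|->]; last by rewrite /sqn dotv0.
rewrite sqnE => /eqP; rewrite psumr_eq0 => [/allP h|i _]; last exact: sqr_ge0.
apply/colP => i; rewrite mxE; apply/eqP.
by have := h i (mem_index_enum _); rewrite /= sqrf_eq0.
Qed.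

Lemma sqn_gt0 n (x : 'cV[R]_n) : (0 < sqn x) = (x != 0).
Proof. by rewrite lt0r sqn_eq0 sqn_ge0 andbT. Qed.

Definition psd n (M : 'M[R]_n) := forall x, 0 <= dotv x (M *m x).

Lemma psd_cauchy_schwarz n (M : 'M[R]_n) x y : M^T = M -> psd M ->
  dotv x (M *m y) ^+ 2 <= dotv x (M *m x) * dotv y (M *m y).
Proof.
move=> Msym Mpsd.
have exp_form s t : dotv (s *: x + t *: y) (M *m (s *: x + t *: y)) =
    s ^+ 2 * dotv x (M *m x) + 2 * s * t * dotv x (M *m y)
    + t ^+ 2 * dotv y (M *m y).
  rewrite mulmxDr -!scalemxAr !(dotvDl, dotvDr, dotvZl, dotvZr).
  have -> : dotv y (M *m x) = dotv x (M *m y) by rewrite dotv_mul Msym dotvC.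
  by ring.
have qx := Mpsd x; have qy := Mpsd y.
move: qx qy exp_form; set a := dotv x (M *m x); set b := dotv x (M *m y).
set c := dotv y (M *m y) => a0 c0 exp_form.
have [c_eq0|c_neq0] := eqVneq c 0.
  rewrite c_eq0 mulr0; have [->|b_neq0] := eqVneq b 0; first by rewrite expr0n.
  (* When [c = 0] and [b != 0], the form takes the value [a - (a + 1) = -1] at this vector. *)
  have := Mpsd (1 *: x + (- (a + 1) / (2 * b)) *: y).
  rewrite exp_form c_eq0 mulr0 addr0 expr1n mul1r.
  have -> : 2 * 1 * (- (a + 1) / (2 * b)) * b = - (a + 1) by field.
  by lra.
have c_gt0 : 0 < c by rewrite lt0r c_neq0.
have := Mpsd (c *: x + (- b) *: y); rewrite exp_form.
have -> : c ^+ 2 * a + 2 * c * - b * b + (- b) ^+ 2 * c = c * (a * c - b ^+ 2).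
  by ring.
by rewrite pmulr_rge0 // subr_ge0.
Qed.

Lemma cauchy_schwarz n (x y : 'cV[R]_n) : dotv x y ^+ 2 <= sqn x * sqn y.
Proof.
have := @psd_cauchy_schwarz n 1%:M x y (trmx1 _ _) _; rewrite !mul1mx; apply.
by move=> z; rewrite mul1mx sqn_ge0.
Qed.

(** Operator norm at most 1 in squared form, which needs no square roots in the field. *)
Definition contractive m n (W : 'M[R]_(m, n)) :=
  forall x, sqn (W *m x) <= sqn x.

(** Convex combinations are built inside an arbitrary predicate of this kind; the convex hull is
    substituted for it only at the end. *)
Definition convex_closed (U : lmodType R) (K : U -> Prop) :=
  forall t x y, 0 <= t <= 1 -> K x -> K y -> K (t *: x + (1 - t) *: y).

End Real.

(** * Sparse contractions as convex combinations of sparse isometries *)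

Section Isometries.
Variables (R : rcfType).

(** The product of the roots of [a t^2 + 2 c t - h] is [- h / a < 0]. A point moved by both roots
    lies between its two images. *)
Lemma quadratic_opposite_roots (a c h : R) : 0 < a -> 0 < h ->
  exists t1 t2, [/\ 0 < t1, t2 < 0, 2 * t1 * c + t1 ^+ 2 * a = h
    & 2 * t2 * c + t2 ^+ 2 * a = h].
Proof.
move=> a0 h0; set s := Num.sqrt (c ^+ 2 + a * h).
have s2 : s ^+ 2 = c ^+ 2 + a * h.
  by rewrite sqr_sqrtr // addr_ge0 ?sqr_ge0 // mulr_ge0 // ltW.
have ah : 0 < a * h by rewrite mulr_gt0.
have s0 : 0 <= s by rewrite sqrtr_ge0.
have cs : `|c| < s.
  by rewrite -(@ltr_pXn2r _ 2%N) ?nnegrE // real_normK ?num_real // s2 ltrDl.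
move: cs; rewrite ltr_norml => /andP[cs1 cs2].
have an : a != 0 by rewrite gt_eqF.
exists ((s - c) / a), ((- s - c) / a); split.
- by rewrite divr_gt0 // subr_gt0.
- by rewrite pmulr_llt0 ?invr_gt0 //; lra.
- apply: (mulfI an); apply/eqP; rewrite -subr_eq0; apply/eqP.
  transitivity (s ^+ 2 - c ^+ 2 - a * h); first by field.
  by rewrite s2; ring.
- apply: (mulfI an); apply/eqP; rewrite -subr_eq0; apply/eqP.
  transitivity (s ^+ 2 - c ^+ 2 - a * h); first by field.
  by rewrite s2; ring.
Qed.

Variables (d r : nat) (S : {set 'I_d}).
Hypothesis rS : (r <= #|S|)%N.

Definition rows_in (m : nat) (W : 'M[R]_(d, m)) :=
  forall i, i \notin S -> row i W = 0.

Lemma rows_in_mulmx m n (W : 'M[R]_(d, m)) (X : 'M[R]_(m, n)) :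
  rows_in W -> rows_in (W *m X).
Proof. by move=> hW i /hW; rewrite row_mul => ->; rewrite mul0mx. Qed.

(** The rows of [W] indexed by [S] form a matrix with [#|S| >= r] rows and rank below [r], so they
    satisfy a nontrivial linear relation; its coefficients, extended by zero, give [w]. *)
Lemma exists_orthogonal (W : 'M[R]_(d, r)) : ~~ row_full W ->
  exists w : 'cV[R]_d, [/\ w != 0, rows_in w & W^T *m w = 0].
Proof.
move=> Wfull; pose E : 'M[R]_(#|S|, d) := \matrix_(i, j) (enum_val i == j)%:R.
have EW : ~~ row_free (E *m W).
  apply: contra Wfull; rewrite -!row_leq_rank => h.
  rewrite /row_full eqn_leq rank_leq_col /=.
  by apply: leq_trans rS (leq_trans h (mxrankM_maxr _ _)).
rewrite -kermx_eq0 in EW.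
have [i hi] : exists i, row i (kermx (E *m W)) != 0.
  apply/existsP; apply: contraNT EW; rewrite negb_exists => /forallP h.
  by apply/eqP/row_matrixP => i; apply/eqP; have := h i; rewrite negbK row0.
set v := row i _ in hi.
have vE : v *m (E *m W) = 0 by rewrite -row_mul mulmx_ker row0.
have EE : E *m E^T = 1%:M.
  apply/matrixP => a b; rewrite !mxE (bigD1 (enum_val a)) //= !mxE eqxx mul1r.
  rewrite big1 ?addr0 => [|j ja]; last by rewrite !mxE eq_sym (negPf ja) mul0r.
  by rewrite (inj_eq enum_val_inj) eq_sym.
exists (v *m E)^T; split.
- apply: contra_neq hi => h; apply: trmx_inj; rewrite trmx0.
  by rewrite -[v]mulmx1 -EE mulmxA trmx_mul h mulmx0.
- move=> j jS; apply/rowP => z; rewrite !mxE big1 // => a _.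
  rewrite !mxE; case: eqP => [e|_]; last by rewrite mulr0.
  by move: jS; rewrite -e enum_valP.
- by rewrite -trmx_mul -mulmxA vE trmx0.
Qed.

(** Let [M = 1 - W^T W]. When [W^T w] is proportional to [M y], moving [W] along [w (M y)^T] changes
    [M] only by a multiple of [(M y) (M y)^T]. *)
Lemma exists_rank1_direction (W : 'M[R]_(d, r)) : rows_in W ->
  1%:M - W^T *m W != 0 ->
  exists (w : 'cV[R]_d) (y : 'cV[R]_r) (c : R),
    [/\ w != 0, rows_in w, (1%:M - W^T *m W) *m y != 0
      & W^T *m w = c *: ((1%:M - W^T *m W) *m y)].
Proof.
set M := 1%:M - _ => WS M0.
have colN0 m (A : 'M[R]_(m, r)) : A != 0 -> exists x : 'cV_r, A *m x != 0.
  move=> A0; have [j hj] : exists j, col j A != 0.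
    apply/existsP; apply: contraNT A0; rewrite negb_exists => /forallP h.
    apply/eqP/matrixP => i j; have := h j; rewrite negbK => /eqP/colP/(_ i).
    by rewrite !mxE.
  by exists (delta_mx j 0); rewrite -colE.
have MW : M *m (W^T *m W) = W^T *m W *m M.
  by rewrite mulmxBl mulmxBr mul1mx mulmx1.
(* If [W M = 0], then [W] lacks full column rank because [M != 0], and a vector orthogonal to its
   columns works with [c = 0]. *)
have [WM0|/colN0[x wx]] := eqVneq (W *m M) 0.
  have [y My] := colN0 _ _ M0.
  have [|w [w0 wS Ww]] := @exists_orthogonal W.
    apply: contra M0 => /row_fullP[B BW].
    by rewrite -[M]mul1mx -BW -mulmxA WM0 mulmx0.
  by exists w, y, 0; rewrite scale0r.
(* Since [M] commutes with [W^T W], [W^T (W M x) = M (W^T W x)]. *)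
exists (W *m M *m x), (W^T *m W *m x), 1; split => //.
- by rewrite -mulmxA; exact: rows_in_mulmx.
- apply: contra wx; rewrite mulmxA MW => /eqP h.
  rewrite -sqn_eq0 /sqn -{2}mulmxA dotv_mul -[_ *m x]mulmxA.
  by move: h; rewrite -!mulmxA => ->; rewrite dotv0l.
- by rewrite scale1r [M *m (_ *m x)]mulmxA MW !mulmxA.
Qed.

(** The new matrix factors through [M] on the right and kills [y], which [M] does not, so its row
    space is strictly smaller. *)
Lemma rank_downdate (M : 'M[R]_r) (y : 'cV[R]_r) : M^T = M -> M *m y != 0 ->
  let h := dotv y (M *m y) in
  h != 0 -> (\rank (M - h^-1 *: (M *m y *m (M *m y)^T))%R < \rank M)%N.
Proof.
move=> Msym My0 h h0; set N := M - _.
have NM : N = (1%:M - h^-1 *: (M *m y *m y^T)) *m M.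
  by rewrite /N trmx_mul Msym mulmxBl mul1mx -scalemxAl !mulmxA.
rewrite ltnNge; apply: contra My0 => MN.
have /andP[_ /submxP[D DN]] : (N == M)%MS.
  by rewrite -(geq_leqif (mxrank_leqif_eq _)) // NM submxMl.
rewrite DN -mulmxA mulmxBl -scalemxAl mulmx_rank1 dotvC -/h.
by rewrite scalerA mulVf // scale1r subrr mulmx0.
Qed.

(** Cauchy-Schwarz for the form of [M]: [(x^T M y)^2 <= h x^T M x]. *)
Lemma psd_downdate (M : 'M[R]_r) (y : 'cV[R]_r) : M^T = M -> psd M ->
  let h := dotv y (M *m y) in
  0 < h -> psd (M - h^-1 *: (M *m y *m (M *m y)^T)).
Proof.
move=> Msym Mpsd h h0 x.
rewrite mulmxBl dotvDr dotvNr -scalemxAl mulmx_rank1 !dotvZr.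
rewrite [dotv (M *m y) x]dotvC subr_ge0 mulrC -ler_pdivlMr ?invr_gt0 //.
by rewrite invrK -expr2; exact: psd_cauchy_schwarz.
Qed.

Lemma contraction_psd (W : 'M[R]_(d, r)) :
  contractive W <-> psd (1%:M - W^T *m W).
Proof.
have E x : dotv x ((1%:M - W^T *m W) *m x) = sqn x - sqn (W *m x).
  by rewrite mulmxBl mul1mx dotvDr dotvNr -mulmxA dotv_mul trmxK.
by split => h x; have := h x; rewrite E subr_ge0.
Qed.

(** Induction on the rank of [M = 1 - W^T W]; rank 0 means an isometry. Otherwise [W] moves both
    ways along [w (M y)^T], up to the two points where [M] loses the rank-one part
    [h^-1 (M y) (M y)^T] with [h = y^T M y]. *)
Lemma contraction_mem_convex (K : 'M[R]_(d, r) -> Prop) : convex_closed K ->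
  (forall W, rows_in W -> W^T *m W = 1%:M -> K W) ->
  forall W, rows_in W -> contractive W -> K W.
Proof.
move=> Kconv Kiso W; have [n] := ubnP (\rank (1%:M - W^T *m W)%R).
elim: n W => // n IH W; rewrite ltnS => rk WS /contraction_psd Wc.
have [M0|M0] := eqVneq (1%:M - W^T *m W) 0.
  by apply: Kiso => //; apply/esym/eqP; rewrite -subr_eq0 M0.
have [w [y [c [w0 wS My Ww]]]] := exists_rank1_direction WS M0.
move: M0 My Ww rk Wc; set M := 1%:M - _ => M0 My Ww rk Wc.
have Msym : M^T = M by rewrite linearB /= trmx1 trmx_mul trmxK.
have h0 : 0 < dotv y (M *m y).
  rewrite lt0r Wc andbT; apply: contra My => /eqP h; rewrite -sqn_eq0.
  have := psd_cauchy_schwarz (M *m y) y Msym Wc; rewrite h mulr0.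
  by rewrite -/(sqn _) exprn_even_le0.
have hV : 0 < (dotv y (M *m y))^-1 by rewrite invr_gt0.
have [t1 [t2 [t1p t2n e1 e2]]] := quadratic_opposite_roots c (a := sqn w)
  (h := (dotv y (M *m y))^-1) (etrans (sqn_gt0 w) w0) hV.
pose P t := W + t *: (w *m (M *m y)^T).
have PM t : 2 * t * c + t ^+ 2 * sqn w = (dotv y (M *m y))^-1 ->
    1%:M - (P t)^T *m P t =
    M - (dotv y (M *m y))^-1 *: (M *m y *m (M *m y)^T).
  move=> <-; rewrite /P {P}; move: Ww; move: (M *m y) => u Ww.
  have wW : w^T *m W = c *: u^T.
    by rewrite -[W]trmxK -trmx_mul Ww linearZ.
  have ww : w^T *m w = (sqn w)%:M by rewrite -mx11_scalar.
  have -> : (W + t *: (w *m u^T))^T = W^T + t *: (u *m w^T).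
    by rewrite [LHS]linearD /= [X in _ + X]linearZ /= trmx_mul trmxK.
  rewrite mulmxDl !mulmxDr.
  rewrite -!scalemxAl -!scalemxAr -!mulmxA [W^T *m (w *m _)]mulmxA Ww wW.
  rewrite [w^T *m (w *m _)]mulmxA ww mul_scalar_mx -!scalemxAl -!scalemxAr.
  rewrite !scalerA /M; set U := u *m u^T.
  apply/matrixP => i j; rewrite !mxE. ring.
have KP t : 2 * t * c + t ^+ 2 * sqn w = (dotv y (M *m y))^-1 -> K (P t).
  move=> ht; apply: IH.
  - rewrite PM //; apply: leq_trans rk; apply: rank_downdate => //.
    by rewrite gt_eqF.
  - move=> i iS; rewrite linearD linearZ /= WS // row_mul wS // mul0mx scaler0.
    by rewrite addr0.
  - by apply/contraction_psd; rewrite PM //; exact: psd_downdate.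
(* [W = P 0], and [t2 < 0 < t1]. *)
have -> : W = (- t2 / (t1 - t2)) *: P t1 + (1 - - t2 / (t1 - t2)) *: P t2.
  have t12 : t1 - t2 != 0 by rewrite gt_eqF // subr_gt0 (lt_trans t2n).
  rewrite /P; set U := w *m _.
  by apply/matrixP => i j; rewrite !mxE; field.
apply: Kconv; [|exact: KP|exact: KP].
have t12 : 0 < t1 - t2 by rewrite subr_gt0 (lt_trans t2n).
by rewrite divr_ge0 ?oppr_ge0 ?ler_pdivrMr ?ltW ?mul1r //=; lra.
Qed.
End Isometries.

(** * Little Grothendieck weights *)

Section SignAverage.
Variables (R : rcfType) (n : nat).
Implicit Types (f g : 'cV[R]_n -> R) (l : seq 'cV[R]_n) (z v : 'cV[R]_n).

(** The expectation of [f] at the Rademacher sum of the vectors of [l], started at [z]; the starting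
    point carries the inductions. *)
Fixpoint sign_avg f l z : R :=
  if l is u :: l' then (sign_avg f l' (z + u) + sign_avg f l' (z - u)) / 2
  else f z.

Lemma sign_avg_le f g l z : (forall x, f x <= g x) ->
  sign_avg f l z <= sign_avg g l z.
Proof.
move=> fg; elim: l z => [|u l IH] z /=; first exact: fg.
by rewrite ler_pM2r ?invr_gt0 // lerD.
Qed.

Lemma sign_avg_lin a b f g l z :
  sign_avg (fun x => a * f x + b * g x) l z =
  a * sign_avg f l z + b * sign_avg g l z.
Proof. by elim: l z => [|u l IH] z //=; rewrite !IH; ring. Qed.

Lemma sign_avg_cst a l z : sign_avg (fun=> a) l z = a.
Proof. by elim: l z => [|u l IH] z //=; rewrite !IH; field. Qed.

Lemma sign_avg_sum (I : Type) (s : seq I) (F : I -> 'cV[R]_n -> R) l z :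
  sign_avg (fun x => \sum_(i <- s) F i x) l z =
  \sum_(i <- s) sign_avg (F i) l z.
Proof.
elim: l z => [|u l IH] z //=; rewrite !IH -big_split /= mulr_suml.
by apply: eq_bigr.
Qed.

Lemma sign_avg_sqn l z : sign_avg (@sqn _ _) l z = sqn z + \sum_(g <- l) sqn g.
Proof.
elim: l z => [|u l IH] z /=; first by rewrite big_nil addr0.
by rewrite !IH big_cons !sqnD sqnN dotvNr; field.
Qed.

Lemma sign_avg_dot2 v l z : sign_avg (fun x => dotv v x ^+ 2) l z =
  dotv v z ^+ 2 + \sum_(g <- l) dotv v g ^+ 2.
Proof.
elim: l z => [|u l IH] z /=; first by rewrite big_nil addr0.
by rewrite !IH big_cons !dotvDr dotvNr; field.
Qed.

(** The right side is the fourth moment of a Gaussian with the same mean and variance. Adding a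
    vector [u] leaves a slack of [2 b^4] with [b = dotv v u]. *)
Lemma sign_avg_dot4 v l z : sign_avg (fun x => dotv v x ^+ 4) l z <=
  dotv v z ^+ 4 + 6 * dotv v z ^+ 2 * (\sum_(g <- l) dotv v g ^+ 2) +
  3 * (\sum_(g <- l) dotv v g ^+ 2) ^+ 2.
Proof.
elim: l z => [|u l IH] z /=; first by rewrite big_nil mulr0 expr0n mulr0 !addr0.
have := IH (z + u); have := IH (z - u).
rewrite big_cons !dotvDr dotvNr; set S := \sum_(g <- l) _.
set a := dotv v z; set b := dotv v u => h1 h2.
have b4 : 0 <= b ^+ 4 by rewrite exprn_even_ge0.
rewrite ler_pdivrMr //; apply: le_trans (lerD h2 h1) _; rewrite -subr_ge0.
set X := (X in 0 <= X); suff -> : X = 4 * b ^+ 4 by lra.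
by rewrite /X; ring.
Qed.

(* Averages the pointwise bound [|x| >= x^2 / s - (4/27) x^4 / s^3]. *)
Lemma khintchine v l :
  Num.sqrt (\sum_(g <- l) dotv v g ^+ 2) <=
  2 * sign_avg (fun x => `|dotv v x|) l 0.
Proof.
set S := \sum_(g <- l) _.
have S0 : 0 <= S by rewrite sumr_ge0 // => g _; rewrite sqr_ge0.
have [->|Sn] := eqVneq S 0.
  rewrite sqrtr0 mulr_ge0 // -[0](sign_avg_cst 0 l 0).
  by apply: sign_avg_le.
set s := Num.sqrt S; have s2 : s ^+ 2 = S by rewrite sqr_sqrtr.
have s0 : 0 < s by rewrite sqrtr_gt0 lt0r Sn.
pose a := s^-1; pose b := - (4 / 27) / s ^+ 3.
have le1 x : a * dotv v x ^+ 2 + b * dotv v x ^+ 4 <= `|dotv v x|.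
  have -> : dotv v x ^+ 4 = (dotv v x ^+ 2) ^+ 2 by rewrite -exprM.
  rewrite -[dotv v x ^+ 2]real_normK ?num_real //.
  have : 0 <= `|dotv v x| by [].
  set y := `|_| => y0; have [t yE t0] : exists2 t, y = t * s & 0 <= t.
    by exists (y / s); rewrite ?divfK ?gt_eqF // divr_ge0 // ltW.
  rewrite yE -subr_ge0; set X := (X in 0 <= X).
  (* The coefficient 4/27 is the one that produces a double root, at [t = 3/2]. *)
  have -> : X = s * t * (1 - 2 / 3 * t) ^+ 2 * (1 + t / 3).
    by rewrite /X /a /b; field; rewrite gt_eqF.
  rewrite mulr_ge0 ?addr_ge0 ?divr_ge0 // mulr_ge0 ?sqr_ge0 // mulr_ge0 //.
  exact: ltW.
have := sign_avg_le l 0 le1; rewrite sign_avg_lin sign_avg_dot2 dotv0.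
have := sign_avg_dot4 v l 0; rewrite dotv0 !expr0n /= mulr0 mul0r !add0r -/S.
set Q := sign_avg _ _ _; set L := sign_avg _ _ _ => h4 h.
have bQ : b * (3 * S ^+ 2) <= b * Q.
  by rewrite ler_wnM2l // /b mulNr oppr_le0 divr_ge0 ?exprn_ge0 ?divr_ge0 //
    ltW.
have e1 : a * S = s by rewrite -s2 /a; field; rewrite gt_eqF.
have e2 : b * (3 * S ^+ 2) = - (4 / 9) * s.
  by rewrite -s2 /b; field; rewrite gt_eqF.
(* [L >= (1 - 4/9) s = 5/9 s], which exceeds [s / 2]. *)
by move: h bQ; rewrite e1 e2; lra.
Qed.
End SignAverage.

Section Weights.
Variables (R : rcfType) (d r : nat) (V : 'M[R]_(d, r)) (kappa : R).
Hypotheses (r0 : (0 < r)%N) (kappa0 : 0 <= kappa).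
Hypothesis V21 : forall x, \sum_i `|(V *m x) i 0| <= kappa * Num.sqrt (sqn x).
Hypothesis Vrow :
  \sum_i Num.sqrt (sqn (row i V)^T) <= Num.sqrt r%:R * kappa.

(** Khintchine's inequality in each row exchanges the square function for the sign average of the
    1-norm of [V x]. The bound [V21] and [|x| <= (|x|^2 + 1) / 2] then leave only a second
    moment. *)
Lemma sum_sqrt_le (l : seq 'cV[R]_r) : \sum_(g <- l) sqn g <= 1 ->
  \sum_i Num.sqrt (\sum_(g <- l) (V *m g) i 0 ^+ 2) <= 2 * kappa.
Proof.
move=> l1; apply: le_trans (_ : \sum_i
    2 * sign_avg (fun x => `|(V *m x) i 0|) l 0 <= _).
  apply: ler_sum => i _; have := khintchine (row i V)^T l.
  under eq_bigr do rewrite -mulmx_row.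
  by under [X in sign_avg X]eq_fun do rewrite -mulmx_row.
rewrite -mulr_sumr -sign_avg_sum ler_pM2l //.
have le1 x : \sum_i `|(V *m x) i 0| <= kappa / 2 * sqn x + kappa / 2 * 1.
  apply: le_trans (V21 x) _; have := sqr_sqrtr (sqn_ge0 x).
  set s := Num.sqrt _ => <-.
  rewrite -mulrDr -mulrA ler_wpM2l // ler_pdivlMl //.
  by have := sqr_ge0 (s - 1); rewrite sqrrB1; lra.
apply: le_trans (sign_avg_le _ _ le1) _.
rewrite sign_avg_lin sign_avg_sqn sign_avg_cst /sqn dotv0 add0r.
have : kappa / 2 * \sum_(g <- l) sqn g <= kappa / 2 * 1.
  by rewrite ler_wpM2l // divr_ge0.
by rewrite /sqn; lra.
Qed.

(** This term keeps the weights of nonzero rows positive. It also dominates the contribution of any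
    vector of squared norm [1 / r], so one such vector at most doubles [w l i ^+ 2]. By [Vrow] its
    square roots sum to at most [kappa]. *)
Let base i : R := sqn (row i V)^T / r%:R.
Let w (l : seq 'cV[R]_r) i : R :=
  Num.sqrt (\sum_(g <- l) (V *m g) i 0 ^+ 2 + base i).
Let good l := forall x, \sum_i (V *m x) i 0 ^+ 2 / w l i <= 6 * kappa * sqn x.

Let rR : 0 < r%:R :> R. Proof. by rewrite ltr0n. Qed.

Let base0 i : 0 <= base i.
Proof. by rewrite divr_ge0 ?sqn_ge0. Qed.

Let S0 (l : seq 'cV[R]_r) i : 0 <= \sum_(g <- l) (V *m g) i 0 ^+ 2.
Proof. by rewrite sumr_ge0 // => g _; rewrite sqr_ge0. Qed.

Let w0 l i : 0 <= w l i. Proof. exact: sqrtr_ge0. Qed.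

Let w2 l i : w l i ^+ 2 = \sum_(g <- l) (V *m g) i 0 ^+ 2 + base i.
Proof. by rewrite sqr_sqrtr // addr_ge0. Qed.

Let sum_base : \sum_i w [::] i <= kappa.
Proof.
rewrite -(@ler_pM2l _ (Num.sqrt r%:R)) ?sqrtr_gt0 //; apply: le_trans Vrow.
rewrite mulr_sumr ler_sum // => i _.
rewrite /w big_nil add0r /base -sqrtrM ?ler0n // mulrC divfK //.
by rewrite gt_eqF.
Qed.

Let sum_w_le l : \sum_(g <- l) sqn g <= 1 ->
  \sum_i w l i <= 2 * kappa + \sum_i w [::] i.
Proof.
move=> l1; apply: le_trans (lerD (sum_sqrt_le l1) (lexx _)).
rewrite -big_split /= ler_sum // => i _.
rewrite -(@ler_pXn2r _ 2%N) ?nnegrE ?addr_ge0 ?sqrtr_ge0 // w2 sqrrD.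
rewrite sqr_sqrtr // w2 big_nil add0r lerD2r lerDl mulrn_wge0 //.
by rewrite mulr_ge0 // sqrtr_ge0.
Qed.

(** A direction violating [good] is scaled to squared norm [1 / r]. Since [(1 + t / 3)^2 <= 1 + t]
    for [0 <= t <= 1], each weight [u] gains at least a third of the increment of its square divided
    by [u]; the violated bound [6 kappa] turns into [2 kappa / r]. *)
Let weight_gain l : ~ good l -> exists2 g, sqn g = r%:R^-1 &
  \sum_i w l i + 2 * kappa / r%:R < \sum_i w (g :: l) i.
Proof.
move=> /existsNP[x] /negP; rewrite -ltNge => hx.
have x0 : 0 < sqn x.
  rewrite sqn_gt0; apply/eqP => x0; move: hx.
  rewrite x0 /sqn dotv0 mulr0 big1 ?ltxx // => i _.
  by rewrite mulmx0 mxE expr0n mul0r.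
pose a : R := r%:R * sqn x; have a0 : 0 < a by rewrite mulr_gt0.
pose g := (Num.sqrt a)^-1 *: x.
have sa : (Num.sqrt a)^-1 ^+ 2 = a^-1 by rewrite exprVn sqr_sqrtr ?ltW.
have sg : sqn g = r%:R^-1.
  by rewrite sqnZ sa /a invfM mulrVK // unitfE gt_eqF.
exists g => //.
have Vg i : (V *m g) i 0 ^+ 2 = (V *m x) i 0 ^+ 2 / a.
  by rewrite -scalemxAr mxE exprMn sa mulrC.
have gain i : w l i + (V *m x) i 0 ^+ 2 / w l i / (3 * a) <= w (g :: l) i.
  have bw : (V *m g) i 0 ^+ 2 <= w l i ^+ 2.
    by rewrite w2 ler_wpDl // mulmx_row /base -sg cauchy_schwarz.
  have -> : (V *m x) i 0 ^+ 2 / w l i / (3 * a) = (V *m g) i 0 ^+ 2 / w l i / 3.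
    by rewrite Vg invfM; ring.
  have w'2 : w (g :: l) i ^+ 2 = (V *m g) i 0 ^+ 2 + w l i ^+ 2.
    by rewrite !w2 big_cons addrA.
  have b0 : 0 <= (V *m g) i 0 ^+ 2 by exact: sqr_ge0.
  have wi := w0 l i.
  rewrite -(@ler_pXn2r _ 2%N) ?nnegrE ?addr_ge0 ?divr_ge0 // w'2.
  move: bw b0 wi; set b := _ ^+ 2; set u := w l i => bw b0 wi.
  (* Inversion sends 0 to 0, so the claimed gain vanishes in this case. *)
  have [->|u0] := eqVneq u 0; first by rewrite invr0 mulr0 mul0r addr0 lerDr.
  have {}wi : 0 < u by rewrite lt0r u0.
  have -> : (u + b / u / 3) ^+ 2 = u ^+ 2 + 2 / 3 * b + b * (b / u ^+ 2) / 9.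
    by field.
  have : b / u ^+ 2 <= 1 by rewrite ler_pdivrMr ?exprn_gt0 // mul1r.
  move=> /(ler_wpM2l b0); lra.
apply: lt_le_trans (ler_sum _ (fun i _ => gain i)).
rewrite big_split /= ltrD2l -mulr_suml ltr_pdivlMr ?mulr_gt0 //.
apply: le_lt_trans hx; rewrite /a le_eqVlt; apply/orP; left; apply/eqP.
by field; rewrite gt_eqF.
Qed.

(** The strict inequality is available once a vector has been appended; at [n = r] it contradicts
    [sum_w_le]. *)
Let greedy n : (n <= r)%N ->
  (exists2 l, \sum_(g <- l) sqn g <= 1 & good l) \/
  exists l, [/\ \sum_(g <- l) sqn g = n%:R / r%:R,
    \sum_i w [::] i + 2 * kappa * (n%:R / r%:R) <= \sum_i w l i &
    (0 < n)%N -> \sum_i w [::] i + 2 * kappa * (n%:R / r%:R) < \sum_i w l i].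
Proof.
elim: n => [_|n IH nr].
  by right; exists [::]; rewrite big_nil mul0r mulr0 addr0; split.
have [|[l [l1 l2 _]]] := IH (ltnW nr); first by left.
have [gl|/weight_gain[g g1 g2]] := pselect (good l).
  left; exists l => //; rewrite l1 ler_pdivrMr // mul1r ler_nat.
  exact: ltnW.
right; exists (g :: l).
have e : n.+1%:R / r%:R = n%:R / r%:R + r%:R^-1 :> R.
  by rewrite -natr1 mulrDl mul1r.
have lt : \sum_i w [::] i + 2 * kappa * (n.+1%:R / r%:R) < \sum_i w (g :: l) i.
  by apply: le_lt_trans g2; rewrite e mulrDr addrA lerD2r.
by split => //; [rewrite big_cons g1 l1 e addrC | exact: ltW].
Qed.

(* The little Grothendieck theorem for V : l2 -> l1.  As long as the last
   inequality fails in some direction, a short vector in that direction is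
   appended to [l], which raises the total weight; after [r] steps the total
   would exceed what Khintchine's inequality allows. *)
Lemma exists_weights : exists u : 'I_d -> R,
  [/\ forall i, 0 <= u i, forall i, u i = 0 -> row i V = 0,
      \sum_i u i <= 3 * kappa
    & forall x, \sum_i (V *m x) i 0 ^+ 2 / u i <= 6 * kappa * sqn x].
Proof.
have [[l l1 gl]|[l [l1 _ /(_ r0)]]] := greedy (leqnn r); last first.
  rewrite divff ?gt_eqF // in l1 *; rewrite mulr1 addrC ltNge.
  by rewrite sum_w_le // l1.
exists (w l); split => [//|i wi| |//].
  have /eqP := w2 l i; rewrite wi expr0n eq_sym paddr_eq0 // => /andP[_].
  rewrite mulf_eq0 invr_eq0 (gt_eqF rR) orbF sqn_eq0 => /eqP h.
  by apply: trmx_inj; rewrite h trmx0.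
by apply: le_trans (sum_w_le l1) _; move: sum_base; lra.
Qed.
End Weights.

(** * Sampling rows *)

Lemma convex_sum (R : realFieldType) (U : lmodType R) (K : U -> Prop)
    (I : eqType) (s : seq I) (c : I -> R) (F : I -> U) :
  convex_closed K -> (forall i, 0 <= c i) -> (forall i, K (F i)) ->
  0 < \sum_(i <- s) c i ->
  K ((\sum_(i <- s) c i)^-1 *: \sum_(i <- s) c i *: F i).
Proof.
move=> Kc c0 KF; elim: s => [|a s IH]; first by rewrite big_nil ltxx.
rewrite !big_cons; set S := \sum_(i <- s) c i; set G := \sum_(i <- s) _.
have S0 : 0 <= S by exact: sumr_ge0.
have [Sz|Sn] := eqVneq S 0.
  have G0 : G = 0.
    rewrite /G big_seq big1 // => i si; move/eqP: Sz.
    rewrite psumr_eq0 // => /allP/(_ _ si)/eqP ->; exact: scale0r.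
  rewrite Sz G0 !addr0 => a0; rewrite scalerA mulVf ?gt_eqF //.
  by rewrite scale1r.
have Sp : 0 < S by rewrite lt0r Sn.
have := IH Sp; rewrite -/S -/G => KG sp.
have -> : (c a + S)^-1 *: (c a *: F a + G) =
    (c a / (c a + S)) *: F a + (1 - c a / (c a + S)) *: (S^-1 *: G).
  rewrite scalerDr !scalerA mulrC; congr (_ + _ *: _); field.
  by rewrite Sn gt_eqF.
apply: Kc => //; by rewrite divr_ge0 ?(ltW sp) //= ler_pdivrMr // mul1r lerDl.
Qed.

Section Sampling.
Variables (R : rcfType) (d : nat) (p : 'I_d -> R).
Hypotheses (p0 : forall i, 0 <= p i) (p1 : \sum_i p i = 1).

(** The expectation of [F] over [k] independent indices of law [p]. *)
Fixpoint iid_avg (U : lmodType R) (k : nat) (F : seq 'I_d -> U) : U :=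
  if k is k'.+1 then \sum_i p i *: iid_avg k' (fun l => F (i :: l))
  else F [::].

Lemma iid_avg_convex (U : lmodType R) (K : U -> Prop) k F : convex_closed K ->
  (forall l, size l = k -> K (F l)) -> K (iid_avg k F).
Proof.
move=> Kc; elim: k F => [|k IH] F KF /=; first exact: KF.
have := @convex_sum _ _ K _ (index_enum _) p
  (fun i => iid_avg k (fun l => F (i :: l))) Kc p0.
rewrite p1 invr1 scale1r; apply => // i; apply: IH => l lk.
by apply: KF; rewrite /= lk.
Qed.

Lemma iid_avg_linear (U W : lmodType R) (phi : U -> W) k F :
  (forall a u v, phi (a *: u + v) = a *: phi u + phi v) ->
  phi (iid_avg k F) = iid_avg k (fun l => phi (F l)).
Proof.
move=> lin; have phi0 : phi 0 = 0.
  have := lin 1 0 0; rewrite !scale1r addr0 => h.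
  by apply: (addrI (phi 0)); rewrite addr0.
elim: k F => [//|k IH] F /=.
elim/big_rec2: _ => [//|i y1 y2 _ <-].
by rewrite lin IH.
Qed.

Lemma iid_avgD (U : lmodType R) k (F G : seq 'I_d -> U) :
  iid_avg k (fun l => F l + G l) = iid_avg k F + iid_avg k G.
Proof.
elim: k F G => [//|k IH] F G /=.
by rewrite -big_split /=; apply: eq_bigr => i _; rewrite IH scalerDr.
Qed.

Lemma iid_avg_cst (U : lmodType R) k (u : U) : iid_avg k (fun=> u) = u.
Proof. by elim: k => [//|k IH] /=; rewrite IH -scaler_suml p1 scale1r. Qed.

Lemma iid_avg_le k (F G : seq 'I_d -> R^o) : (forall l, F l <= G l) ->
  iid_avg k F <= iid_avg k G.
Proof.
elim: k F G => [//|k IH] F G FG /=; first exact: FG.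
by apply: ler_sum => i _; apply: ler_wpM2l => //; exact: IH.
Qed.

Lemma iid_avg_sum (U : lmodType R) (I : Type) (s : seq I) k
    (F : I -> seq 'I_d -> U) :
  iid_avg k (fun l => \sum_(i <- s) F i l) = \sum_(i <- s) iid_avg k (F i).
Proof.
elim: k F => [//|k IH] F /=; rewrite exchange_big /=.
by apply: eq_bigr => i _; rewrite IH scaler_sumr.
Qed.

Lemma iid_avgZ (U : lmodType R) k a (F : seq 'I_d -> U) :
  iid_avg k (fun l => a *: F l) = a *: iid_avg k F.
Proof.
by rewrite (@iid_avg_linear _ _ (fun u => a *: u)) // => b u v;
  rewrite scalerDr !scalerA mulrC.
Qed.

Lemma iid_avg_count k i :
  iid_avg k (fun l => (count_mem i l)%:R : R^o) = k%:R * p i.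
Proof.
elim: k => [|k IH] /=; first by rewrite mul0r.
under eq_bigr => j _.
  under [X in iid_avg k X]eq_fun do rewrite natrD.
  rewrite iid_avgD IH iid_avg_cst scalerDr; over.
rewrite big_split /= -scaler_suml p1 scale1r (bigD1 i) //= eqxx big1 => [|j ji].
  by rewrite addr0 -natr1 mulrDl mul1r addrC [_ *: _]mulr1.
by rewrite (negPf ji) scaler0.
Qed.

(** The second moment of a binomial count, with [k (k - 1) p^2] relaxed to [k^2 p^2]; each draw
    leaves a slack [p i ^+ 2]. *)
Lemma iid_avg_count2 k i :
  iid_avg k (fun l => (count_mem i l)%:R ^+ 2 : R^o) <=
  k%:R * p i + (k%:R * p i) ^+ 2.
Proof.
elim: k => [|k IH] /=; first by rewrite mul0r expr0n addr0.
have E j : iid_avg k (fun l => ((j == i) + count_mem i l)%:R ^+ 2 : R^o) =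
   (j == i)%:R * (1 + 2 * (k%:R * p i)) +
   iid_avg k (fun l => (count_mem i l)%:R ^+ 2 : R^o).
  have -> : (fun l => ((j == i) + count_mem i l)%:R ^+ 2 : R^o) = (fun l =>
      (j == i)%:R *: ((1 : R^o) + 2 *: ((count_mem i l)%:R : R^o)) +
      (count_mem i l)%:R ^+ 2).
    by apply/funext => l; rewrite natrD /GRing.scale /=; case: (j == i) => /=;
      ring.
  by rewrite iid_avgD iid_avgZ iid_avgD iid_avgZ iid_avg_cst iid_avg_count.
under eq_bigr do rewrite E scalerDr.
rewrite big_split /= -scaler_suml p1 scale1r (bigD1 i) //= eqxx big1 ?addr0.
  move: IH; set Q := iid_avg _ _ => IH; rewrite mul1r /GRing.scale /=.
  apply: le_trans (lerD (lexx _) IH) _.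
  rewrite -natr1 -subr_ge0; set X := (X in 0 <= X).
  have -> : X = p i ^+ 2 by rewrite /X; ring.
  exact: sqr_ge0.
by move=> j ji; rewrite (negPf ji) mul0r scaler0.
Qed.

Variables (r : nat) (c : 'I_d -> 'M[R]_(d, r)).

(** Entries already passed are pushed into [H], so each position is multiplied by [H] at the list
    with that position alone removed. *)
Fixpoint leave_one_out (H : seq 'I_d -> 'M[R]_r) (l : seq 'I_d) :
    'M[R]_(d, r) :=
  if l is i :: l' then c i *m H l' + leave_one_out (fun s => H (i :: s)) l'
  else 0.

(** A draw is independent of those left after its removal, so each of the [k.+1] positions
    contributes the product of two means. *)
Lemma iid_avg_leave_one_out k H : iid_avg k.+1 (leave_one_out H) =
  k.+1%:R *: ((\sum_i p i *: c i) *m iid_avg k H).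
Proof.
elim: k H => [|k IH] H.
  rewrite /= scale1r mulmx_suml; apply: eq_bigr => i _.
  by rewrite addr0 scalemxAl.
have step i : iid_avg k.+1 (fun l => leave_one_out H (i :: l)) =
    c i *m iid_avg k.+1 H +
    k.+1%:R *: ((\sum_i p i *: c i) *m iid_avg k (fun s => H (i :: s))).
  rewrite -IH (@iid_avg_linear _ _ (mulmx (c i))) -?iid_avgD // => a u v.
  by rewrite mulmxDr scalemxAr.
transitivity (\sum_i p i *: iid_avg k.+1 (fun l => leave_one_out H (i :: l))).
  by [].
under eq_bigr do rewrite step scalerDr.
rewrite big_split /= -[k.+2%:R]nat1r scalerDl scale1r; congr (_ + _).
  rewrite mulmx_suml; apply: eq_bigr => i _; exact: scalemxAl.
rewrite mulmx_sumr scaler_sumr; apply: eq_bigr => i _.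
by rewrite -scalemxAr !scalerA mulrC.
Qed.

(** Removing any occurrence of [i] gives the same list up to permutation, so equal indices
    contribute equal terms. *)
Lemma leave_one_outE H l : (forall s t, perm_eq s t -> H s = H t) ->
  leave_one_out H l = \sum_i (count_mem i l)%:R *: (c i *m H (rem i l)).
Proof.
elim: l H => [|i l IH] H Hp; first by rewrite big1 // => i _; rewrite scale0r.
rewrite /= IH => [|s t st]; last by apply: Hp; rewrite perm_cons.
rewrite (bigD1 i) //= [in RHS](bigD1 i) //= eqxx natrD scalerDl scale1r.
rewrite addrA; congr (_ + _ + _).
  have [il|il] := boolP (i \in l); last by rewrite (count_memPn il) !scale0r.
  by congr (_ *: (_ *m _)); apply: Hp; rewrite perm_sym perm_to_rem.
by apply: eq_bigr => j ji; rewrite eq_sym (negPf ji).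
Qed.

End Sampling.

(** * Regularized Gram matrices and their inverses *)

Section Gram.
Variables (R : rcfType) (d r : nat) (A : 'M[R]_(d, r)).
Implicit Types (m : 'I_d -> nat) (x y z : 'cV[R]_r).

(** Multiplicities are squared because row [i] of a sample carries the factor [m i]. The shift 16
    limits the effect of deleting one draw. *)
Definition gram m : 'M[R]_r :=
  16%:M + \sum_i (m i)%:R ^+ 2 *: ((row i A)^T *m row i A).

Lemma gram_mul m y : gram m *m y =
  16 *: y + \sum_i ((m i)%:R ^+ 2 * (A *m y) i 0) *: (row i A)^T.
Proof.
rewrite mulmxDl mul_scalar_mx mulmx_suml; congr (_ + _); apply: eq_bigr => i _.
by rewrite -scalemxAl -[row i A in LHS]trmxK mulmx_rank1 -mulmx_row trmxK
  scalerA.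
Qed.

Lemma gram_dot m x y : dotv x (gram m *m y) =
  16 * dotv x y + \sum_i (m i)%:R ^+ 2 * (A *m x) i 0 * (A *m y) i 0.
Proof.
rewrite gram_mul dotvDr dotvZr dotv_sumr; congr (_ + _); apply: eq_bigr => i _.
by rewrite dotvZr dotvC -mulmx_row; ring.
Qed.

Lemma gram_tr m : (gram m)^T = gram m.
Proof.
rewrite linearD /= tr_scalar_mx linear_sum; congr (_ + _).
by apply: eq_bigr => i _; rewrite linearZ /= trmx_mul trmxK.
Qed.

Let energy m x := \sum_i (m i)%:R ^+ 2 * (A *m x) i 0 ^+ 2.

Lemma gram_sqn m x : dotv x (gram m *m x) = 16 * sqn x + energy m x.
Proof.
by rewrite gram_dot; congr (_ + _); apply: eq_bigr => i _; rewrite -mulrA expr2.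
Qed.

Lemma energy_ge0 m x : 0 <= energy m x.
Proof. by rewrite sumr_ge0 // => i _; rewrite mulr_ge0 ?sqr_ge0. Qed.

Lemma gram_psd m : psd (gram m).
Proof.
by move=> x; rewrite gram_sqn addr_ge0 ?energy_ge0 // mulr_ge0 ?sqn_ge0.
Qed.

Lemma posdef_unit (M : 'M[R]_r) (t : R) : 0 < t ->
  (forall x, t * sqn x <= dotv x (M *m x)) -> M \in unitmx.
Proof.
move=> t0 h; rewrite -unitmx_tr -row_free_unit -kermx_eq0.
apply/eqP/row_matrixP => i; rewrite row0; set v := row i _.
have vM : v *m M^T = 0 by rewrite -row_mul mulmx_ker row0.
have Mv : M *m v^T = 0 by rewrite -[M]trmxK -trmx_mul vM trmx0.
have := h v^T; rewrite Mv dotv0 pmulr_rle0 // => s.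
have : sqn v^T == 0 by rewrite eq_le s sqn_ge0.
by rewrite sqn_eq0 => /eqP e; rewrite -[v]trmxK e trmx0.
Qed.

Lemma gram_unit m : gram m \in unitmx.
Proof.
apply: (@posdef_unit _ 16) => // x.
by rewrite gram_sqn lerDl energy_ge0.
Qed.

Lemma gramK m y : gram m *m (invmx (gram m) *m y) = y.
Proof. by rewrite mulKVmx ?gram_unit. Qed.

Lemma dot_invgram m x y :
  dotv x (invmx (gram m) *m y) = dotv (invmx (gram m) *m x) y.
Proof. by rewrite dotv_mul trmx_inv gram_tr. Qed.

(** With [gram m = 16 + E], this is the operator form of [4 * 16 * E <= (16 + E)^2]. The factor 32
    is twice the shift, which cancels the terms in [sqn y]. *)
Lemma energy_invgram m z : 64 * energy m (invmx (gram m) *m z) <= sqn z.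
Proof.
set y := _ *m z; have e := gram_sqn m y; rewrite gramK in e.
have : 0 <= sqn (z - 32 *: y) by exact: sqn_ge0.
by rewrite sqnD sqnN dotvNr dotvZr sqnZ dotvC; move: e; lra.
Qed.

(* From [0 <= dotv u (N *m u)] with [u = N^-1 x - t x]. *)
Lemma invgram_ge m x (t : R) :
  2 * t * sqn x - t ^+ 2 * dotv x (gram m *m x) <= dotv x (invmx (gram m) *m x).
Proof.
have := gram_psd m (invmx (gram m) *m x - t *: x).
rewrite mulmxBr gramK -scalemxAr dotvDl !dotvDr !dotvNr !dotvNl !dotvZl !dotvZr.
rewrite -!dot_invgram mulKmx ?gram_unit // /sqn.
set a := dotv x _; set b := dotv x x.
by set c := dotv x _; lra.
Qed.

(* [g = N'^-1 a] is [beta N^-1 a], where [N = N' + (2 n + 1) a a^T]; [beta <= 2]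
   since [s = a^T g] satisfies [(4 + n^2) s^2 <= s]. *)
Lemma invgram_decr m m' i n z : sqn (row i A)^T <= 4 ->
  m i = n.+1 -> m' i = n -> (forall j, j != i -> m' j = m j) ->
  (A *m (invmx (gram m') *m z)) i 0 ^+ 2 <=
  4 * (A *m (invmx (gram m) *m z)) i 0 ^+ 2.
Proof.
move=> a4 mi m'i m'j; set a := (row i A)^T in a4 *.
set g := invmx (gram m') *m a; set s := (A *m g) i 0.
have gE : dotv a g = s by rewrite /s mulmx_row.
have N'g : gram m' *m g = a by exact: gramK.
have Ng : gram m *m g = (1 + (2 * n%:R + 1) * s) *: a.
  rewrite scalerDl scale1r -[X in _ = X + _]N'g !gram_mul -!addrA.
  congr (_ + _); rewrite (bigD1 i) //= [in RHS](bigD1 i) //= mi m'i -/s.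
  rewrite addrAC -scalerDl; congr (_ *: _ + _); first by rewrite -natr1; ring.
  by apply: eq_bigr => j /m'j ->.
have {}Ng : g = (1 + (2 * n%:R + 1) * s) *: (invmx (gram m) *m a).
  by rewrite scalemxAr -Ng mulKmx ?gram_unit.
have -> : (A *m (invmx (gram m') *m z)) i 0 =
    (1 + (2 * n%:R + 1) * s) * (A *m (invmx (gram m) *m z)) i 0.
  by rewrite !mulmx_row -/a !dot_invgram -dotvZl -Ng.
rewrite exprMn ler_wpM2r ?sqr_ge0 //.
have s1 : 4 * s ^+ 2 <= 16 * sqn g.
  have := cauchy_schwarz a g; rewrite gE => h.
  have : sqn a * sqn g <= 4 * sqn g by rewrite ler_wpM2r ?sqn_ge0.
  by lra.
have s2 : 16 * sqn g + n%:R ^+ 2 * s ^+ 2 <= s.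
  rewrite -[X in _ <= X]gE dotvC -[in X in _ <= X]N'g gram_sqn lerD2l /energy.
  rewrite (bigD1 i) //= m'i -/s lerDl sumr_ge0 // => j _.
  by rewrite mulr_ge0 ?sqr_ge0.
have n0 : 0 <= 2 * n%:R + 1 :> R by rewrite addr_ge0 // mulr_ge0.
have s3 : (2 * n%:R + 1) * s ^+ 2 <= s.
  (* Here [4 + n^2 - (2 n + 1) = (n - 1)^2 + 2]. *)
  have : 0 <= s ^+ 2 * ((n%:R - 1) ^+ 2 + 2).
    by rewrite mulr_ge0 ?addr_ge0 ?sqr_ge0.
  by move: s1 s2; rewrite sqrrB1 -mulr_natl; lra.
have s0 : 0 <= s by apply: le_trans s3; rewrite mulr_ge0 ?sqr_ge0.
have b1 : (2 * n%:R + 1) * s <= 1.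
  have [->|sn] := eqVneq s 0; first by rewrite mulr0.
  have sp : 0 < s by rewrite lt0r sn.
  by rewrite -(ler_pM2r sp) mul1r -mulrA -expr2.
have b0 : 0 <= (2 * n%:R + 1) * s by rewrite mulr_ge0.
by move: b0 b1; set b := _ * s => b0 b1; nra.
Qed.
End Gram.

(** * Random rounding to row-sparse matrices *)

Section Rounding.
Variables (R : rcfType) (d r k : nat) (V : 'M[R]_(d, r)) (q : 'I_d -> R).
Hypotheses (q0 : forall i, 0 <= q i) (qk : \sum_i q i = k.+1%:R).
Hypothesis Vq : forall i, sqn (row i V)^T <= 4 * q i ^+ 2.
Hypothesis Vw : forall x, \sum_i (V *m x) i 0 ^+ 2 / q i <= 36 * sqn x.
Hypothesis Vc : contractive V.

Let A : 'M[R]_(d, r) := \matrix_(i, j) (V i j / q i).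
Let p i := q i / k.+1%:R.
Let resolvent (l : seq 'I_d) := invmx (gram A (fun i => count_mem i l)).
Let c i : 'M[R]_(d, r) := (delta_mx i 0 : 'cV_d) *m row i A.
Let sample := leave_one_out c resolvent.
(** Only [k] of the [k.+1] draws enter, since one is left out. *)
Let mean_resolvent := iid_avg p k (resolvent : _ -> 'M[R]_r).

Lemma sampling_prob_ge0 i : 0 <= p i.
Proof. by rewrite divr_ge0. Qed.

Lemma sampling_prob_sum : \sum_i p i = 1.
Proof. by rewrite -mulr_suml qk divff // pnatr_eq0. Qed.

Let p0 := sampling_prob_ge0.
Let p1 := sampling_prob_sum.

(** At a zero weight, [Vq] makes the row of [V] zero. *)
Lemma sampling_row i : row i V = q i *: row i A.
Proof.
apply/rowP => j; rewrite !mxE.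
have [qi|qi] := eqVneq (q i) 0; last by rewrite mulrC divfK.
have : sqn (row i V)^T <= 0.
  by apply: le_trans (Vq i) _; rewrite qi expr0n mulr0.
rewrite le_eqVlt ltNge sqn_ge0 orbF sqn_eq0 qi mul0r => /eqP/colP/(_ j).
by rewrite !mxE.
Qed.

Lemma sampling_mul i (x : 'cV[R]_r) : (V *m x) i 0 = q i * (A *m x) i 0.
Proof. by rewrite mulmx_row sampling_row linearZ dotvZl -mulmx_row. Qed.

Lemma sampling_row_sqn i : sqn (row i A)^T <= 4.
Proof.
have := Vq i; rewrite sampling_row linearZ sqnZ mulrC.
have [qi|qi] := eqVneq (q i) 0; last first.
  by rewrite ler_pM2r // exprn_even_gt0.
move=> _; have -> : row i A = 0; last by rewrite trmx0 /sqn dotv0.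
by apply/rowP => j; rewrite !mxE qi invr0 mulr0.
Qed.

(** [53 = 16 + 36 + 1]: the shift of the Gram matrix, then [Vw] and [Vc] for the two parts of the
    bound [q i + q i ^+ 2] on the second moment of the count of [i]. *)
Lemma sampling_energy x : iid_avg p k (fun l =>
    dotv x (gram A (fun i => count_mem i l) *m x) : R^o) <= 53 * sqn x.
Proof.
have -> : (fun l => dotv x (gram A (fun i => count_mem i l) *m x) : R^o) =
  (fun l => 16 * sqn x + \sum_i (A *m x) i 0 ^+ 2 *:
    ((count_mem i l)%:R ^+ 2 : R^o)).
  apply/funext => l; rewrite gram_sqn; congr (_ + _).
  by apply: eq_bigr => i _; rewrite mulrC.
rewrite iid_avgD iid_avg_cst // iid_avg_sum.
have le1 : \sum_i iid_avg p k (fun l =>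
    (A *m x) i 0 ^+ 2 *: ((count_mem i l)%:R ^+ 2 : R^o)) <=
    \sum_i ((V *m x) i 0 ^+ 2 / q i + (V *m x) i 0 ^+ 2).
  apply: ler_sum => i _; rewrite iid_avgZ sampling_mul.
  have kq : k%:R * p i <= q i.
    by rewrite /p mulrCA ler_piMr // ler_pdivrMr // mul1r ler_nat.
  have kp0 : 0 <= k%:R * p i by rewrite mulr_ge0.
  apply: le_trans (_ : (A *m x) i 0 ^+ 2 * (q i + q i ^+ 2) <= _).
    rewrite ler_wpM2l ?sqr_ge0 //; apply: le_trans (iid_avg_count2 p1 _ _) _.
    by rewrite lerD // lerXn2r // nnegrE.
  have [->|qi] := eqVneq (q i) 0.
    by rewrite !mul0r expr0n /= mul0r !addr0 mulr0.
  rewrite le_eqVlt; apply/orP; left; apply/eqP; field.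
  by [].
apply: le_trans (lerD (lexx _) le1) _; rewrite big_split /= -sqnE.
by have := Vw x; have := Vc x; lra.
Qed.

(** Jensen's inequality for the inverse, through the bound [invgram_ge], which is affine in the Gram
    matrix: at [t = 1/53] it yields [2/53 - 53/53^2 = 1/53]. *)
Lemma mean_resolvent_coercive x : 53^-1 * sqn x <= dotv x (mean_resolvent *m x).
Proof.
pose phi (M : 'M[R]_r) : R^o := dotv x (M *m x).
have lin a M N : phi (a *: M + N) = a *: phi M + phi N.
  by rewrite /phi mulmxDl -scalemxAl dotvDr dotvZr.
rewrite -[dotv x _]/(phi mean_resolvent) /mean_resolvent iid_avg_linear //.
have := @iid_avg_le _ _ _ p0 k _ _
  (fun l => invgram_ge A (fun i => count_mem i l) x 53^-1).
apply: le_trans; rewrite -/(sqn x).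
have -> : (fun l => 2 / 53 * sqn x - 53^-1 ^+ 2 *
    dotv x (gram A (fun i => count_mem i l) *m x)) =
  (fun l => (2 / 53 * sqn x : R^o) + (- (53^-1 ^+ 2)) *:
    (dotv x (gram A (fun i => count_mem i l) *m x) : R^o)).
  by apply/funext => l; rewrite scaleNr.
rewrite iid_avgD iid_avg_cst // iid_avgZ scaleNr.
rewrite /GRing.scale /=.
by have := sampling_energy x; set E := iid_avg _ _ _; lra.
Qed.

Lemma mean_resolvent_unit : mean_resolvent \in unitmx.
Proof. by apply: posdef_unit mean_resolvent_coercive; rewrite invr_gt0. Qed.

Lemma inv_mean_resolvent_le (z : 'cV[R]_r) :
  sqn (invmx mean_resolvent *m z) <= 53 ^+ 2 * sqn z.
Proof.
set x := _ *m z; have := mean_resolvent_coercive x.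
rewrite mulKVmx ?mean_resolvent_unit // => h.
have := cauchy_schwarz x z => cs.
have [x0|x0] := eqVneq (sqn x) 0.
  by rewrite x0 mulr_ge0 ?sqn_ge0 // exprn_ge0.
have xp : 0 < sqn x by rewrite lt0r x0 sqn_ge0.
rewrite -(ler_pM2l xp).
have : (53^-1 * sqn x) ^+ 2 <= dotv x z ^+ 2.
  have c0 : 0 <= 53^-1 * sqn x by rewrite mulr_ge0 ?invr_ge0 ?sqn_ge0.
  by rewrite lerXn2r // nnegrE (le_trans c0).
by rewrite exprMn exprVn; move: cs; lra.
Qed.

(** The number [k.+1] of positions cancels the denominator of [p], and the rows [q i *: row i A] are
    those of [V]. *)
Lemma mean_sample : iid_avg p k.+1 sample = V *m mean_resolvent.
Proof.
rewrite iid_avg_leave_one_out scalemxAl; congr (_ *m _).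
apply/row_matrixP => i; rewrite sampling_row; apply/rowP => j.
rewrite !mxE summxE (bigD1 i) //= big1 => [|a ai].
  rewrite addr0 !mxE big_ord1 !mxE !eqxx mul1r /p.
  by rewrite !mulrA [_ * (q i)]mulrC mulfK // pnatr_eq0.
by rewrite !mxE big_ord1 !mxE eq_sym (negPf ai) mul0r mulr0.
Qed.

Lemma resolvent_perm s t : perm_eq s t -> resolvent s = resolvent t.
Proof. by move=> /permP st; congr (invmx (gram _ _)); apply/funext => i. Qed.

Lemma sample_mul l (z : 'cV[R]_r) i : (sample l *m z) i 0 =
  (count_mem i l)%:R * (A *m (resolvent (rem i l) *m z)) i 0.
Proof.
rewrite /sample leave_one_outE; last exact: resolvent_perm.
rewrite mulmx_suml summxE (bigD1 i) //= big1 => [|a ai].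
  rewrite addr0 -scalemxAl mxE /c -!mulmxA; congr (_ * _).
  by rewrite mxE big_ord1 mxE !eqxx mul1r -row_mul mxE.
rewrite -scalemxAl mxE /c -!mulmxA [X in _ * X]mxE big_ord1 mxE eq_sym.
by rewrite (negPf ai) mul0r mulr0.
Qed.

(** By [invgram_decr], deleting one copy of [i] at most quadruples the squared entry, so the squared
    norm is at most 4 times the energy at the full resolvent; [energy_invgram] bounds 64 times that
    energy. *)
Lemma sample_sqn_le l (z : 'cV[R]_r) : 16 * sqn (sample l *m z) <= sqn z.
Proof.
apply: le_trans (energy_invgram A (fun i => count_mem i l) z).
rewrite (_ : 64 = 16 * 4) -?mulrA ?ler_pM2l //; last by ring.
rewrite sqnE mulr_sumr ler_sum // => i _.
rewrite sample_mul exprMn [4 * _]mulrCA.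
have [il|/count_memPn ->] := boolP (i \in l); last by rewrite expr0n !mul0r.
have cnt j : count_mem j (rem i l) = (count_mem j l - (i == j))%N.
  by rewrite count_rem il.
case ci: (count_mem i l) => [|n]; first by rewrite expr0n !mul0r.
rewrite -ci ler_wpM2l ?sqr_ge0 //.
apply: (invgram_decr _ (sampling_row_sqn i) ci).
  by rewrite cnt ci eqxx subn1.
by move=> j ji; rewrite cnt eq_sym (negPf ji) subn0.
Qed.

Lemma sample_rows_in l : rows_in [set i in l] (sample l).
Proof.
move=> i; rewrite inE => il; apply/rowP => j.
rewrite /sample leave_one_outE; last exact: resolvent_perm.
rewrite !mxE summxE big1 // => a _.
have [->|ai] := eqVneq a i; first by rewrite (count_memPn il) scale0r mxE.
rewrite mxE /c -mulmxA [X in _ * X]mxE big_ord1 mxE eq_sym (negPf ai).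
by rewrite mul0r mulr0.
Qed.

(** By [mean_sample], [V] is the mean of the samples times the inverse of the mean resolvent: norm
    at most 1/4 times norm at most 53. *)
Lemma rounding_mem_convex (K : 'M[R]_(d, r) -> Prop) (rho : R) :
  convex_closed K ->
  (forall (S : {set 'I_d}) W, (#|S| <= k.+1)%N -> rows_in S W ->
    contractive W -> K W) ->
  53 / 4 <= rho -> K (rho^-1 *: V).
Proof.
move=> Kc KS rho0.
have -> : rho^-1 *: V =
    iid_avg p k.+1 (fun l => rho^-1 *: (sample l *m invmx mean_resolvent)).
  rewrite iid_avgZ -(@iid_avg_linear _ _ _ _ _
    (fun M => M *m invmx mean_resolvent)).
    by rewrite mean_sample mulmxK ?mean_resolvent_unit.
  by move=> a u v; rewrite mulmxDl scalemxAl.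
apply: (iid_avg_convex p0 p1 Kc) => l lk.
apply: (KS [set i in l]).
- by rewrite -lk (leq_trans _ (card_size l)) // cardsE.
- rewrite scalemxAr; apply: rows_in_mulmx; exact: sample_rows_in.
move=> z; rewrite -scalemxAl sqnZ -mulmxA.
have := sample_sqn_le l (invmx mean_resolvent *m z).
have := inv_mean_resolvent_le z.
set a := sqn _; set b := sqn _; set e := sqn _ => h1 h2.
have rp : 0 < rho by apply: lt_le_trans rho0; rewrite divr_gt0.
rewrite exprVn ler_pdivrMl ?exprn_gt0 //.
have : (53 / 4) ^+ 2 <= rho ^+ 2 by rewrite lerXn2r // nnegrE ?divr_ge0 ?ltW.
move=> /(ler_wpM2r (sqn_ge0 z)); rewrite -/b expr_div_n.
by move: h1 h2; lra.
Qed.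
End Rounding.

(** * The sets F and CR1 *)

Section Norms.
Variable R : realType.

Lemma lpnorm2E n (x : 'cV[R]_n) : lpnorm 2 x = Num.sqrt (sqn x).
Proof.
rewrite /lpnorm powR12_sqrt ?sumr_ge0 //.
congr Num.sqrt; rewrite sqnE; apply: eq_bigr => i _.
by rewrite powR_mulrn // real_normK ?num_real.
Qed.

Lemma lpnorm1E n (x : 'cV[R]_n) : lpnorm 1 x = \sum_i `|x i 0|.
Proof.
rewrite /lpnorm invr1 powRr1 ?sumr_ge0 //.
by apply: eq_bigr => i _; rewrite powRr1.
Qed.

Lemma lpnorm2_eq1 n (x : 'cV[R]_n) : (lpnorm 2 x = 1) <-> (sqn x = 1).
Proof.
rewrite lpnorm2E; split => [h|->]; last exact: sqrtr1.
by rewrite -[sqn x]sqr_sqrtr ?sqn_ge0 // h expr1n.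
Qed.

(** A supremum is an upper bound only for a set that is bounded above, so [bnd] asks for some bound
    [M], however crude. *)
Lemma le_opnorm2 (q b M : R) d r (V : 'M[R]_(d, r)) :
  (forall a (y : 'cV[R]_d), 0 <= a -> lpnorm q (a *: y) = a * lpnorm q y) ->
  (forall x, sqn x = 1 -> lpnorm q (V *m x) <= M) ->
  opnorm 2 q V <= b -> forall x, lpnorm q (V *m x) <= b * Num.sqrt (sqn x).
Proof.
move=> hom bnd Vb x; have [->|x0] := eqVneq x 0.
  have := hom 0 (V *m 0) (lexx _); rewrite scale0r mulmx0 mul0r => ->.
  by rewrite /sqn dotv0 sqrtr0 mulr0.
have s0 : 0 < Num.sqrt (sqn x) by rewrite sqrtr_gt0 sqn_gt0.
pose y := (Num.sqrt (sqn x))^-1 *: x.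
have y1 : sqn y = 1.
  by rewrite sqnZ exprVn sqr_sqrtr ?sqn_ge0 // mulVf // sqn_eq0.
have -> : x = Num.sqrt (sqn x) *: y by rewrite scalerA divff ?scale1r ?gt_eqF.
rewrite -scalemxAr hom ?(ltW s0) // sqnZ y1 mulr1 sqrtr_sqr.
rewrite ger0_norm ?(ltW s0) // [leLHS]mulrC ler_pM2r //; apply: le_trans Vb.
apply: ub_le_sup; last by exists y => //; apply/lpnorm2_eq1.
by exists M => _ [z /lpnorm2_eq1 z1 <-]; exact: bnd.
Qed.

(** [0 < r] provides a unit vector; the supremum of an empty set would be a default value. *)
Lemma opnorm2_le (q b : R) d r (V : 'M[R]_(d, r)) : (0 < r)%N ->
  (forall x, sqn x = 1 -> lpnorm q (V *m x) <= b) -> opnorm 2 q V <= b.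
Proof.
move=> r0 h; apply: ge_sup => [|_ [x /lpnorm2_eq1 x1 <-]]; last exact: h.
pose e : 'cV[R]_r := delta_mx (Ordinal r0) 0.
exists (lpnorm q (V *m e)); exists e => //; apply/lpnorm2_eq1.
rewrite sqnE (bigD1 (Ordinal r0)) //= mxE !eqxx expr1n big1 ?addr0 // => i i0.
by rewrite mxE (negPf i0) expr0n.
Qed.

Lemma sqn_mul_le d r (V : 'M[R]_(d, r)) x :
  sqn (V *m x) <= (\sum_i sqn (row i V)^T) * sqn x.
Proof.
rewrite sqnE mulr_suml ler_sum // => i _.
by rewrite mulmx_row cauchy_schwarz.
Qed.

Lemma opnorm22_contraction d r (V : 'M[R]_(d, r)) :
  opnorm 2 2 V <= 1 -> contractive V.
Proof.
move=> h x.
(* The Frobenius norm serves as the crude bound. *)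
have := @le_opnorm2 2 1 (Num.sqrt (\sum_i sqn (row i V)^T)) _ _ V _ _ h x.
rewrite !lpnorm2E mul1r ler_sqrt ?sqn_ge0 //; apply => [a y a0|z z1].
  by rewrite !lpnorm2E sqnZ sqrtrM ?sqr_ge0 // sqrtr_sqr ger0_norm.
rewrite lpnorm2E ler_wsqrtr //; have := sqn_mul_le V z.
by rewrite z1 mulr1.
Qed.

Lemma opnorm21_le d r (V : 'M[R]_(d, r)) b : opnorm 2 1 V <= b ->
  forall x, \sum_i `|(V *m x) i 0| <= b * Num.sqrt (sqn x).
Proof.
move=> h x; rewrite -lpnorm1E; apply: (le_opnorm2 _ _ h) => [a y a0|z z1].
  rewrite !lpnorm1E mulr_sumr; apply: eq_bigr => i _.
  by rewrite mxE normrM ger0_norm.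
(* The crude bound is chosen here as the sum of the row norms. *)
rewrite lpnorm1E; apply: (_ : _ <= \sum_i Num.sqrt (sqn (row i V)^T)).
apply: ler_sum => i _; rewrite -sqrtr_sqr ler_wsqrtr //.
by rewrite mulmx_row (le_trans (cauchy_schwarz _ _)) // z1 mulr1.
Qed.

Lemma sum_le_sqrt_card n (P : pred 'I_n) (F : 'I_n -> R) :
  (forall i, 0 <= F i) ->
  \sum_(i | P i) F i <= Num.sqrt (#|P|%:R * \sum_i F i ^+ 2).
Proof.
move=> F0; have S0 : 0 <= \sum_(i | P i) F i by exact: sumr_ge0.
rewrite -[leLHS]ger0_norm // -sqrtr_sqr ler_wsqrtr //.
pose x : 'cV[R]_n := \col_i (P i)%:R; pose y := \col_i F i.
have <- : dotv x y = \sum_(i | P i) F i.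
  rewrite dotvE [RHS]big_mkcond; apply: eq_bigr => i _; rewrite !mxE.
  by case: (P i); rewrite ?mul1r ?mul0r.
have <- : sqn x = #|P|%:R.
  rewrite sqnE -sum1_card natr_sum [RHS]big_mkcond; apply: eq_bigr => i _.
  by rewrite mxE unfold_in; case: (P i); rewrite ?expr1n ?expr0n.
have <- : sqn y = \sum_i F i ^+ 2.
  by rewrite sqnE; apply: eq_bigr => i _; rewrite mxE.
exact: cauchy_schwarz.
Qed.

(** The 1-norm of [V x] and the sum of the row norms have at most [k] nonzero terms each. By
    Cauchy-Schwarz it remains to sum the squares: 1 in the first case, the trace [r] of [V^T V] in
    the second. *)
Lemma calF_CR1 d r k : (0 < r)%N -> calF R d r k `<=` CR1 R d r k.
Proof.
move=> r0 V [Viso Vk].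
have iso x : sqn (V *m x) = sqn x.
  by rewrite /sqn dotv_mul mulmxA Viso mul1mx.
pose P := [pred i : 'I_d | row i V != 0].
have rowP0 i : ~~ P i -> row i V = 0 by rewrite negbK => /eqP.
split.
- by apply: opnorm2_le => // x x1; rewrite lpnorm2E iso x1 sqrtr1.
- apply: opnorm2_le => // x x1; rewrite lpnorm1E (bigID P) /=.
  rewrite [X in _ + X]big1 ?addr0 => [|i /rowP0 Vi]; last first.
    by rewrite mulmx_row Vi trmx0 dotv0l normr0.
  apply: le_trans (sum_le_sqrt_card _ _) _ => [i|]; first exact: normr_ge0.
  rewrite ler_wsqrtr //; under eq_bigr do rewrite real_normK ?num_real //.
  by rewrite -sqnE iso x1 mulr1 ler_nat.
- rewrite (bigID P) /= [X in _ + X]big1 ?addr0 => [|i /rowP0 Vi]; last first.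
    by rewrite lpnorm2E Vi trmx0 /sqn dotv0 sqrtr0.
  apply: le_trans (sum_le_sqrt_card _ _) _ => [i|]; first exact: powR_ge0.
  rewrite ler_wsqrtr // natrM mulrC.
  have -> : \sum_i lpnorm 2 (row i V)^T ^+ 2 = r%:R.
    under eq_bigr do rewrite lpnorm2E sqr_sqrtr ?sqn_ge0 // sqnE.
    rewrite exchange_big /= -[RHS]mxtrace1 -Viso /mxtrace.
    apply: eq_bigr => j _; rewrite mxE; apply: eq_bigr => i _.
    by rewrite !mxE.
  by rewrite ler_wpM2l // ler_nat.
Qed.
End Norms.

(** * From CR1 to the convex hull of F *)

Section Main.
Variable R : realType.

Lemma conv_hull_convex (E : lmodType R) (S : set E) :
  convex_closed (conv_hull S).
Proof.
move=> t x y /andP[t0 t1] Sx Sy C [Cconv SC].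
have xC : x \in (C : set (convex_lmodType E)) by rewrite inE; apply: Sx.
have yC : y \in (C : set (convex_lmodType E)) by rewrite inE; apply: Sy.
have := Cconv x y (Itv01 t0 t1) xC yC.
by rewrite inE.
Qed.

Lemma exists_superset_card (T : finType) (S : {set T}) k :
  (#|S| <= k)%N -> (k <= #|T|)%N ->
  exists S' : {set T}, S \subset S' /\ #|S'| = k.
Proof.
elim: k => [|k IH] Sk kT.
  by exists S; split => //; apply/eqP; rewrite -leqn0.
move: Sk; rewrite leq_eqVlt => /predU1P[Sk|Sk]; first by exists S.
have [S' [SS' S'k]] := IH Sk (ltnW kT).
have /card_gt0P[x xS'] : (0 < #|~: S'|)%N.
  by rewrite -(ltn_add2l #|S'|) cardsC addn0 S'k.
exists (x |: S'); split.
  by rewrite (fintype.subset_trans SS') ?finset.subsetUr.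
by move: xS'; rewrite inE cardsU1 S'k => ->.
Qed.

(** The support may have fewer than [r] indices, too few for an isometry, so it is first enlarged to
    exactly [k >= r] rows. *)
Lemma sparse_contraction_conv_hull d r k (S : {set 'I_d}) (W : 'M[R]_(d, r)) :
  (r <= k)%N -> (k <= d)%N -> (#|S| <= k)%N -> rows_in S W -> contractive W ->
  conv_hull (calF R d r k) W.
Proof.
move=> rk kd Sk WS Wc.
have [S' [SS' S'k]] : exists S' : {set 'I_d}, S \subset S' /\ #|S'| = k.
  by apply: exists_superset_card; rewrite ?card_ord.
have rS' : (r <= #|S'|)%N by rewrite S'k.
apply: (contraction_mem_convex rS' (K := conv_hull (calF R d r k))) => //.
- exact: conv_hull_convex.
- move=> V VS' Viso; apply: sub_gen_smallest; split => //.
  rewrite -S'k /nnz_rows subset_leq_card //; apply/fintype.subsetP => i.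
  by rewrite inE; apply: contraR => /VS' ->.
- by move=> i iS'; apply: WS; apply: contra iS'; apply/fintype.subsetP.
Qed.

Lemma CR1_conv_hull d r k (V : 'M[R]_(d, r)) (rho : R) :
  (0 < r)%N -> (r <= k)%N -> (k <= d)%N -> 53 / 4 <= rho -> CR1 R d r k V ->
  conv_hull (calF R d r k) (rho^-1 *: V).
Proof.
case: k => [|k] r0 rk kd rho0 [/opnorm22_contraction Vc V21 Vrow].
  by rewrite leqn0 in rk; rewrite (eqP rk) in r0.
have d0 : (0 < d)%N by exact: leq_trans kd.
have rR : 0 < r%:R :> R by rewrite ltr0n.
set K := Num.sqrt k.+1%:R : R.
have K0 : 0 < K by rewrite sqrtr_gt0.
have K2 : K * K = k.+1%:R by rewrite -expr2 sqr_sqrtr.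
set s := Num.sqrt r%:R : R.
have s0 : 0 < s by rewrite sqrtr_gt0.
have sK : s <= K by rewrite ler_wsqrtr // ler_nat.
have {}Vrow : \sum_i Num.sqrt (sqn (row i V)^T) <= s * K.
  rewrite /s /K -sqrtrM ?ler0n // -natrM; apply: le_trans Vrow.
  by apply: ler_sum => i _; rewrite lpnorm2E.
have [w [w0 wV sw Vw]] := exists_weights r0 (ltW K0) (opnorm21_le V21) Vrow.
clear V21; clearbody K s.
pose v i := Num.sqrt (sqn (row i V)^T).
have v0 i : 0 <= v i by exact: sqrtr_ge0.
(* The total [k.+1 = K^2] is split in halves: the bounds [3 K] on the sum of [w] and [s K] on the
   sum of [v] give [K^2 / 2] each. The first part yields the constant [36 = 6 / K * (6 K)], the
   second the row bound [v i <= 2 * q i]. *)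
pose b i := K * w i / 6 + K / s * v i / 2.
have b0 i : 0 <= b i.
  by rewrite addr_ge0 // divr_ge0 // mulr_ge0 // ?divr_ge0 // ltW.
have sb : \sum_i b i <= k.+1%:R.
  rewrite big_split /= -2!mulr_suml -2!mulr_sumr -K2.
  have h1 : K * \sum_i w i <= K * (3 * K) by rewrite ler_pM2l.
  have h2 : K / s * \sum_i v i <= K / s * (s * K).
    by rewrite ler_pM2l // divr_gt0.
  have e : K / s * (s * K) = K * K by field; rewrite gt_eqF.
  by move: h1 h2; rewrite e; lra.
(* The remaining mass is spread evenly to make the total exactly [k.+1]. *)
pose q i := b i + (k.+1%:R - \sum_j b j) / d%:R.
have bq i : b i <= q i by rewrite lerDl divr_ge0 // subr_ge0.
apply: (@rounding_mem_convex _ _ _ k V q) rho0 => //.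
- by move=> i; exact: le_trans (bq i).
- rewrite big_split /= sumr_const card_ord -[_ *+ d]mulr_natr.
  rewrite divfK ?pnatr_eq0 -?lt0n //.
  by rewrite addrC subrK.
- move=> i; have vq : v i <= 2 * q i.
    apply: le_trans (_ : 2 * b i <= _); last by rewrite ler_pM2l.
    have : v i <= K / s * v i by rewrite ler_peMl // ler_pdivlMr // mul1r.
    have : 0 <= K * w i by rewrite mulr_ge0 // ltW.
    by rewrite /b; lra.
  have -> : sqn (row i V)^T = v i ^+ 2 by rewrite sqr_sqrtr ?sqn_ge0.
  have -> : 4 * q i ^+ 2 = (2 * q i) ^+ 2 by ring.
  by rewrite lerXn2r // nnegrE // (le_trans _ vq).
- move=> x; apply: le_trans (_ : \sum_i 6 / K * ((V *m x) i 0 ^+ 2 / w i) <= _).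
    apply: ler_sum => i _.
    have [wi|wi] := eqVneq (w i) 0.
      by rewrite mulmx_row wV // trmx0 dotv0l expr0n !mul0r mulr0.
    have wp : 0 < w i by rewrite lt0r wi w0.
    have wq : K * w i / 6 <= q i.
      apply: le_trans (bq i); rewrite lerDl divr_ge0 // mulr_ge0 //.
      by rewrite divr_ge0 // ltW.
    have kw : 0 < K * w i / 6 by rewrite divr_gt0 // mulr_gt0.
    rewrite mulrCA ler_wpM2l ?sqr_ge0 // (_ : 6 / K / w i = (K * w i / 6)^-1).
      by rewrite lef_pV2 // posrE (lt_le_trans kw).
    by field; rewrite wi gt_eqF.
  rewrite -mulr_sumr (_ : 36 * sqn x = 6 / K * (6 * K * sqn x)).
    by rewrite ler_pM2l // divr_gt0.
  by field; rewrite gt_eqF.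
- exact: conv_hull_convex.
- by move=> S W Sk WS Wc; apply: sparse_contraction_conv_hull WS Wc.
Qed.
End Main.

(** * Size and growth of the constant *)

Lemma ln2_gt0 (R : realType) : 0 < ln 2 :> R.
Proof. by rewrite ln_gt0 // ltr1n. Qed.

(** [pi >= 2] makes the first term of the maximum at least 12. *)
Lemma rho_CR1_ge (R : realType) r : 14 <= rho_CR1 R r.
Proof.
rewrite /rho_CR1; have : 2 <= Num.sqrt (2 * pi) :> R.
  rewrite -[leLHS]ger0_norm // -sqrtr_sqr ler_wsqrtr //.
  by have := pi_ge2 R; rewrite expr2; lra.
have : 6 * Num.sqrt (2 * pi) <= Num.max (6 * Num.sqrt (2 * pi))
    (12 * Num.sqrt (log2 (50 * r%:R))) :> R by rewrite le_max lexx.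
by lra.
Qed.

(** [50 <= 2^6 <= r^6], so [50 r <= r^7]. *)
Lemma log2_50_le (R : realType) r : (1 < r)%N ->
  log2 (50 * r%:R) <= 7 / ln 2 * ln r%:R :> R.
Proof.
move=> r1; have l2 := ln2_gt0 R.
have rR : 0 < r%:R :> R by rewrite ltr0n ltnW.
rewrite /log2 mulrAC ler_pM2r ?invr_gt0 //.
rewrite [7 * _]mulr_natl -lnXn // ler_ln ?posrE ?mulr_gt0 ?exprn_gt0 //.
rewrite exprSr ler_pM2r //.
have : 2 ^+ 6 <= r%:R ^+ 6 :> R by rewrite lerXn2r ?nnegrE // ler_nat.
by apply: le_trans; rewrite -natrX ler_nat.
Qed.

Lemma rho_CR1_bigO (R : realType) :
  (rho_CR1 R : nat -> R) =O_\oo (fun r : nat => Num.sqrt (ln (r%:R : R))).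
Proof.
have l2 := ln2_gt0 R; have s2 : 0 < Num.sqrt (ln 2) :> R by rewrite sqrtr_gt0.
pose a : R := 2 + 6 * Num.sqrt (2 * pi).
have a0 : 0 < a by rewrite ltr_wpDr // mulr_ge0.
pose c : R := a / Num.sqrt (ln 2) + 12 * Num.sqrt (7 / ln 2).
apply/eqO_exP; exists c.
  by rewrite ltr_wpDr ?divr_gt0 // mulr_ge0.
(* At [r = 1] the comparison function vanishes; from 2 on, [ln 2 <= ln r] absorbs the constant
   [a]. *)
exists 2%N => // r /= r2.
have rR : 0 < r%:R :> R by rewrite ltr0n (leq_trans _ r2).
rewrite !ger0_norm //; last by apply: le_trans (rho_CR1_ge R r).
have lr : Num.sqrt (ln 2) <= Num.sqrt (ln r%:R) :> R.
  by rewrite ler_wsqrtr // ler_ln ?posrE // ler_nat.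
have h1 : a <= a / Num.sqrt (ln 2) * Num.sqrt (ln r%:R).
  by rewrite mulrAC ler_pdivlMr // ler_pM2l.
have h2 : Num.sqrt (log2 (50 * r%:R)) <=
    Num.sqrt (7 / ln 2) * Num.sqrt (ln r%:R) :> R.
  by rewrite -sqrtrM ?divr_ge0 ?(ltW l2) // ler_wsqrtr // log2_50_le.
have h3 : Num.max (6 * Num.sqrt (2 * pi)) (12 * Num.sqrt (log2 (50 * r%:R))) <=
    6 * Num.sqrt (2 * pi) + 12 * Num.sqrt (log2 (50 * r%:R)) :> R.
  by rewrite ge_max lerDl lerDr !mulr_ge0.
rewrite /rho_CR1 [c * _]mulrDl; apply: le_trans (lerD (lexx _) h3) _.
by rewrite addrA -/a lerD // -mulrA ler_pM2l.
Qed.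

Theorem theorem1 (R : realType) :
  (forall d r k : nat, (1 <= r)%N -> (r <= k)%N -> (k <= d)%N ->
     calF R d r k `<=` CR1 R d r k /\
     CR1 R d r k `<=` [set rho_CR1 R r *: V | V in conv_hull (calF R d r k)]) /\
  (rho_CR1 R : nat -> R) =O_\oo (fun r : nat => Num.sqrt (ln (r%:R : R))).
Proof.
split; last exact: rho_CR1_bigO.
move=> d r k r0 rk kd; split; first exact: calF_CR1.
move=> V VC; have rho0 := rho_CR1_ge R r.
exists ((rho_CR1 R r)^-1 *: V); last first.
  by rewrite scalerA divff ?scale1r // gt_eqF // (lt_le_trans _ rho0).
by apply: CR1_conv_hull VC => //; apply: le_trans rho0; lra.
Qed.
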